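(* For each $j\in\{0,1,2\}$: a) the infimum of $b_j^{(w)}$ over all finite words $w$ in $\{0,1,2\}$ is $0$; b) the supremum of $b_j^{(w)}$ over all finite words $w$ in $\{0,1,2\}$ is $\frac23$.
   Context: Let $$M_0=\tfrac1{15}\begin{pmatrix}9&0&0\\2&2&-1\\2&-1&2\end{pmatrix},\quad M_1=\tfrac1{15}\begin{pmatrix}2&2&-1\\0&9&0\\-1&2&2\end{pmatrix},\quad M_2=\tfrac1{15}\begin{pmatrix}2&-1&2\\-1&2&2\\0&0&9\end{pmatrix}.$$ For a finite word $w=(w_1,\dots,w_m)$ in $\{0,1,2\}$ let $M_w=M_{w_1}M_{w_2}\cdots M_{w_m}$ (identity for the empty word), and, indexing columns by $0,1,2$, define $$b_j^{(w)}=\frac16+\frac12\cdot\frac{\text{sum of the entries of column } j\text{ of }M_w}{\text{sum of all entries of }M_w},\qquad j=0,1,2.$$ (These are the weights expressing the average of the Radon-Nikodym derivative of an energy measure of harmonic functions with respect to the Kusuoka measure over the cell $F_wSG$ of the Sierpinski gasket as a weighted average of its values at the three boundary vertices of the cell.) *)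

(* Defs.v *)
From HB Require Import structures.
From mathcomp Require Import all_boot all_order all_algebra.
From mathcomp Require Import all_classical all_reals.

Set Implicit Arguments.
Unset Strict Implicit.
Unset Printing Implicit Defensive.

Import Order.TTheory GRing.Theory Num.Theory.

Local Open Scope ring_scope.

Definition mx_of_rows (R : nzRingType) (s : seq (seq R)) : 'M[R]_3 :=
  \matrix_(i, j) nth 0 (nth [::] s i) j.

Definition SGmx (R : realType) (k : 'I_3) : 'M[R]_3 :=
  15^-1 *: mx_of_rows
    (nth [::]
       [:: [:: [:: 9;  0;  0]; [::  2;  2; -1]; [::  2; -1; 2]];
           [:: [:: 2;  2; -1]; [::  0;  9;  0]; [:: -1;  2; 2]];
           [:: [:: 2; -1;  2]; [:: -1;  2;  2]; [::  0;  0; 9]]] k).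

(* The product is taken in the order of the letters of w, and is the identity
   matrix for the empty word. *)
Definition SGmx_word (R : realType) (w : seq 'I_3) : 'M[R]_3 :=
  \prod_(k <- w) SGmx R k.

Definition bweight (R : realType) (j : 'I_3) (w : seq 'I_3) : R :=
  6^-1 + 2^-1 * ((\sum_i SGmx_word R w i j) /
                 (\sum_i \sum_k SGmx_word R w i k)).

(* Main.v *)
Require Import Defs.
From mathcomp Require Import all_boot all_order all_algebra.
From mathcomp Require Import all_classical all_reals.
From mathcomp Require Import ring lra.

Import Order.TTheory GRing.Theory Num.Theory.

Local Open Scope classical_set_scope.
Local Open Scope ring_scope.

(** Appending a letter to [w] multiplies the row vector [u] of column sums of
    M_w on the right by one of the three matrices, and the weight of [j] is an
    affine function of the normalised coordinate u_j / S, where S is the sum of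
    the coordinates.  So the claim is that u_j / S has infimum -1/3 and
    supremum 1.

    In the plane S = 1 consider the disc |u|^2 <= 1.  Its centre is
    (1/3,1/3,1/3), its boundary circle passes through the three unit vectors,
    and the coordinate u_j ranges over [-1/3, 1] on it.  Each matrix M_k
    multiplies the quadratic form S^2 - |u|^2 by the positive constant 1/25, so
    the cone over the disc is preserved ([in_cone_colsum]), which gives the
    bounds -S/3 <= u_j <= S ([in_cone_ge], [in_cone_le]).

    Both bounds are approached.  On the disc, M_a is a hyperbolic motion with
    attracting fixed point e_a, so the words a^n lead to e_a
    ([colsum_nseq]); with a = j the coordinate u_j tends to its maximum 1.
    The minimum of u_j on the disc is attained at the point opposite to e_j,
    and this point is the image of e_a under M_k when j, a, k are distinct: the
    a-th row of 15 M_k has the entries 2, 2, -1, with -1 in position j.  Hence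
    the words a^n k make u_j tend to -1/3. *)

Lemma ord3_neq (k : 'I_3) :
  (k + 1 == k = false) * (k + 2 == k = false) * (k + 2 == k + 1 = false).
Proof. by case: k => [[|[|[|//]]] ?]; split. Qed.

Lemma ord3_cover (k l : 'I_3) : [|| l == k, l == k + 1 | l == k + 2].
Proof. by case: k l => [[|[|[|//]]] ?] [[|[|[|//]]] ?]. Qed.

(** The indices are read modulo 3, so that the symmetry between the letters
    reduces computations for an arbitrary letter [k] to one case. *)
Lemma sum_ord3 (V : nmodType) (f : 'I_3 -> V) (k : 'I_3) :
  \sum_l f l = f k + f (k + 1) + f (k + 2).
Proof.
rewrite (bigD1 k) //= (bigD1 (k + 1)) ?ord3_neq //=.
rewrite (bigD1 (k + 2)) ?ord3_neq //= big1 => [|l].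
  by rewrite addr0 addrA.
have := ord3_cover k l.
by case: (l == k); case: (l == k + 1); case: (l == k + 2).
Qed.

Definition colsum (R : realType) (w : seq 'I_3) (l : 'I_3) : R :=
  \sum_i SGmx_word R w i l.

Definition colsum_total (R : realType) (w : seq 'I_3) : R :=
  \sum_l colsum R w l.

Lemma colsum_nil (R : realType) (l : 'I_3) : colsum R [::] l = 1.
Proof.
rewrite /colsum /SGmx_word big_nil (bigD1 l) //= big1 ?mxE ?eqxx ?addr0 //.
by move=> i /negPf il; rewrite mxE il.
Qed.

Lemma bweightE (R : realType) (j : 'I_3) (w : seq 'I_3) :
  bweight R j w = 6^-1 + 2^-1 * (colsum R w j / colsum_total R w).
Proof. by rewrite /bweight /colsum_total /colsum [in RHS]exchange_big. Qed.

(** Writing the third coordinate as the total minus the other two makes the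
    action of M_k uniform in [k]. *)
Lemma sum_mul_SGmx (R : realType) (u : 'I_3 -> R) (k l : 'I_3) :
  \sum_i u i * SGmx R k i l =
  15^-1 * (if l == k then 7 * u k + 2 * \sum_i u i
           else 3 * u l + u k - \sum_i u i).
Proof.
have E0 (H : (0 < 3)%N) : Ordinal H = ord0 by apply: val_inj.
have E1 (H : (1 < 3)%N) : Ordinal H = lift ord0 ord0 by apply: val_inj.
have E2 (H : (2 < 3)%N) : Ordinal H = lift ord0 (lift ord0 ord0)
  by apply: val_inj.
rewrite !big_ord_recl !big_ord0 !mxE.
case: k => [[|[|[|//]]] Hk]; case: l => [[|[|[|//]]] Hl];
  by rewrite -?val_eqE /= ?E0 ?E1 ?E2; field.
Qed.

Lemma colsum_rcons (R : realType) (w : seq 'I_3) (k l : 'I_3) :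
  colsum R (rcons w k) l =
  15^-1 * (if l == k then 7 * colsum R w k + 2 * colsum_total R w
           else 3 * colsum R w l + colsum R w k - colsum_total R w).
Proof.
rewrite -sum_mul_SGmx /colsum /SGmx_word big_rcons /=.
under eq_bigr do rewrite mxE.
by rewrite exchange_big; apply: eq_bigr => i _; rewrite -mulr_suml.
Qed.

Lemma colsum_total_rcons (R : realType) (w : seq 'I_3) (k : 'I_3) :
  colsum_total R (rcons w k) =
  15^-1 * (3 * colsum_total R w + 6 * colsum R w k).
Proof.
rewrite /colsum_total !(sum_ord3 _ _ k) !colsum_rcons eqxx !ord3_neq.
rewrite /colsum_total !(sum_ord3 _ _ k); ring.
Qed.

(** The cone over the disc bounded by the circle through the three unit
    vectors in the plane where the coordinates add up to 1. *)
Definition in_cone (R : realType) (u : 'I_3 -> R) : Prop :=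
  0 < \sum_l u l /\ \sum_l u l ^+ 2 <= (\sum_l u l) ^+ 2.

(** By convexity of the square, |u|^2 is smallest, for given S and u_j, when the
    other two coordinates are equal.  Then S^2 - |u|^2 is half of the product
    below, which is therefore nonnegative on the cone; since S > 0, the two
    factors cannot both be negative. *)
Lemma in_cone_prod_ge0 (R : realType) (u : 'I_3 -> R) (j : 'I_3) :
  in_cone R u -> 0 <= (\sum_l u l - u j) * (\sum_l u l + 3 * u j).
Proof.
rewrite /in_cone !(sum_ord3 _ _ j).
set x := u j; set y := u _; set z := u _ => -[S0 Q].
have := sqr_ge0 (y - z); nra.
Qed.

Lemma in_cone_le (R : realType) (u : 'I_3 -> R) (j : 'I_3) :
  in_cone R u -> u j <= \sum_l u l.
Proof.
move=> Cu; have := in_cone_prod_ge0 R u j Cu; case: Cu => S0 _ H; nra.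
Qed.

Lemma in_cone_ge (R : realType) (u : 'I_3 -> R) (j : 'I_3) :
  in_cone R u -> - (\sum_l u l) <= 3 * u j.
Proof.
move=> Cu; have := in_cone_prod_ge0 R u j Cu; case: Cu => S0 _ H; nra.
Qed.

(** The base case holds because the empty word gives u = (1,1,1), the axis of
    the cone; the step rests on the invariance of S^2 - |u|^2 up to a factor. *)
Lemma in_cone_colsum (R : realType) (w : seq 'I_3) : in_cone R (colsum R w).
Proof.
elim/last_ind: w => [|w k IHw].
  split; rewrite !(sum_ord3 _ _ ord0) !colsum_nil; lra.
have := in_cone_ge R (colsum R w) k IHw.
case: IHw; rewrite -!/(colsum_total R _) => S0 Q ge.
split; rewrite -!/(colsum_total R _) colsum_total_rcons; first by lra.
(* A letter multiplies the quadratic form by 9 / 15^2 = 1/25. *)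
suff -> : \sum_l colsum R (rcons w k) l ^+ 2 =
  (15^-1 * (3 * colsum_total R w + 6 * colsum R w k)) ^+ 2 -
  25^-1 * (colsum_total R w ^+ 2 - \sum_l colsum R w l ^+ 2).
  by lra.
under eq_bigr do rewrite colsum_rcons.
rewrite /colsum_total !(sum_ord3 _ _ k) eqxx !ord3_neq.
by field.
Qed.

(** Among vectors with equal coordinates off [a], 15 M_a acts by A |-> 9 A + 4
    on the coordinate [a] and fixes the others if they are 1, as 2 - 1 = 1.  So
    the direction of [u] converges to e_a; linear growth of A is enough to see
    this. *)
Lemma colsum_nseq (R : realType) (a : 'I_3) (n : nat) :
  exists p A : R, [/\ 0 < p, n.+1%:R <= A &
    forall l, colsum R (nseq n a) l = p * (if l == a then A else 1)].
Proof.
elim: n => [|n [p [A [p0 nA cE]]]].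
  by exists 1, 1; split=> // l; rewrite colsum_nil if_same mulr1.
have SE : colsum_total R (nseq n a) = p * (A + 2).
  by rewrite /colsum_total (sum_ord3 _ _ a) !cE eqxx !ord3_neq; ring.
exists (15^-1 * p), (9 * A + 4); split; first by rewrite mulr_gt0 ?invr_gt0.
  by move: nA; rewrite -!natr1; have := ler0n R n; lra.
move=> l; have -> : nseq n.+1 a = rcons (nseq n a) a.
  by rewrite -cats1 -(nseqD n 1) addn1.
rewrite colsum_rcons !cE eqxx SE.
by case: (l == a); field.
Qed.

Lemma bweight_ge0 (R : realType) (j : 'I_3) (w : seq 'I_3) : 0 <= bweight R j w.
Proof.
have [S0 _] := in_cone_colsum R w; have := in_cone_ge R _ j (in_cone_colsum R w).
rewrite bweightE -!/(colsum_total R _) => H.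
suff : - 3^-1 <= colsum R w j / colsum_total R w by lra.
by rewrite ler_pdivlMr //; move: H; rewrite -/(colsum_total R w); lra.
Qed.

Lemma bweight_le (R : realType) (j : 'I_3) (w : seq 'I_3) :
  bweight R j w <= 2 / 3.
Proof.
have [S0 _] := in_cone_colsum R w; have := in_cone_le R _ j (in_cone_colsum R w).
rewrite bweightE => H.
suff : colsum R w j / colsum_total R w <= 1 by lra.
by rewrite ler_pdivrMr // mul1r.
Qed.

(** The weight is 2/3 - 1 / (A + 2), in terms of the parameter A of
    [colsum_nseq]. *)
Lemma bweight_nseq_ge (R : realType) (j : 'I_3) (n : nat) :
  2 / 3 - n.+1%:R^-1 <= bweight R j (nseq n j).
Proof.
have [p [A [p0 nA cE]]] := colsum_nseq R j n.
have n0 : 0 < n.+1%:R :> R by rewrite ltr0n.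
rewrite bweightE /colsum_total (sum_ord3 _ _ j) !cE eqxx !ord3_neq.
have -> : 6^-1 + 2^-1 * (p * A / (p * A + p * 1 + p * 1)) =
          2 / 3 - (A + 2)^-1.
  field; nra.
rewrite lerD2l lerN2 lef_pV2 ?posrE; lra.
Qed.

(** The long run of [j + 1] brings [u] near e_(j+1), and the last letter [j + 2]
    sends that vertex to the point of the disc opposite to e_j.  The weight is
    1 / (A + 4), in terms of the parameter A of [colsum_nseq]. *)
Lemma bweight_rcons_nseq_le (R : realType) (j : 'I_3) (n : nat) :
  bweight R j (rcons (nseq n (j + 1)) (j + 2)) <= n.+1%:R^-1.
Proof.
have [p [A [p0 nA cE]]] := colsum_nseq R (j + 1) n.
have n0 : 0 < n.+1%:R :> R by rewrite ltr0n.
rewrite bweightE colsum_rcons colsum_total_rcons /colsum_total (sum_ord3 _ _ j).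
rewrite !cE ![j == _]eq_sym !ord3_neq eqxx.
have -> : 6^-1 + 2^-1 *
    (15^-1 * (3 * (p * 1) + p * 1 - (p * 1 + p * A + p * 1)) /
     (15^-1 * (3 * (p * 1 + p * A + p * 1) + 6 * (p * 1)))) = (A + 4)^-1.
  field; nra.
rewrite lef_pV2 ?posrE; lra.
Qed.

Theorem theorem6p4 (R : realType) (j : 'I_3) :
  (has_inf (range (bweight R j)) /\ inf (range (bweight R j)) = 0) /\
  (has_sup (range (bweight R j)) /\ sup (range (bweight R j)) = 2 / 3).
Proof.
have ne : range (bweight R j) !=set0 by exists (bweight R j [::]), [::].
have lb : lbound (range (bweight R j)) 0 by move=> _ [w _ <-]; exact: bweight_ge0.
have ub : ubound (range (bweight R j)) (2 / 3).
  by move=> _ [w _ <-]; exact: bweight_le.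
have hi : has_inf (range (bweight R j)) by split=> //; exists 0.
have hs : has_sup (range (bweight R j)) by split=> //; exists (2 / 3).
have small (e : R) : 0 < e -> exists n : nat, n.+1%:R^-1 < e.
  by move=> /ltr_add_invr[n]; rewrite add0r; exists n.
split; split=> //; apply/eqP; rewrite eq_le; apply/andP; split.
- apply/ler_addgt0Pr => e /small[n lt_e]; rewrite add0r.
  apply: le_trans (ltW lt_e); apply: le_trans (bweight_rcons_nseq_le R j n).
  by apply: ge_inf; [case: hi | exists (rcons (nseq n (j + 1)) (j + 2))].
- exact: lb_le_inf.
- exact: ge_sup.
- apply/ler_addgt0Pr => e /small[n lt_e]; rewrite -lerBlDr.
  apply: (@le_trans _ _ (2 / 3 - n.+1%:R^-1)); first by rewrite lerD2l lerN2 ltW.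
  apply: le_trans (bweight_nseq_ge R j n) _.
  by apply: ub_le_sup; [case: hs | exists (nseq n j)].
Qed.
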